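(* Let $G=(V,E)$ be a connected simple graph with a fixed total order on $E$ and a fixed root vertex $v_d$. There exists an acyclic matching on the Hasse diagram of the NBC chromatic complex $C_{\mathrm{NBC}}(G)$ over $\mathcal{A}_2$ such that the critical basis elements are in one-to-one correspondence with the signed NBC spanning trees of $G$, i.e. with the pairs $(T,\sigma)$, $T$ an NBC spanning tree of $G$, $\sigma\in\{+,-\}$.
   Context: $\mathcal{A}_2=\mathbb{Z}[x]/(x^2)$. An enhanced state is $(H,\epsilon)$ with $H$ a spanning subgraph of $G$ and $\epsilon$ assigning $1$ or $x$ to each component of $H$. The chromatic differential is $d(H,\epsilon)=\sum_{e\notin E(H)}(-1)^{\#\{e'\in E(H):e'<e\}}(H\cup e,\epsilon_e)$, where if $e$ merges components $C_1,C_2$ the merged component gets $\epsilon(C_1)\epsilon(C_2)\in\mathcal{A}_2$ (term zero if the product is $0$) and otherwise $\epsilon_e=\epsilon$. A broken circuit is the edge set of a cycle minus its smallest edge; an edge set is NBC if it contains no broken circuit; an NBC spanning tree is a spanning tree with NBC edge set. $C_{\mathrm{NBC}}(G)$ is the free abelian group on enhanced states with NBC edge set, graded by $|E(H)|$, with differential obtained from $d$ by discarding the terms whose edge set is not NBC. For a cochain complex $(C,\partial)$ with basis $\Omega$, its Hasse diagram is the directed graph on $\Omega$ with an edge $c\to c'$ whenever the coefficient $[c:c']$ of $c'$ in $\partial c$ is nonzero. A matching is a set of such edges, no two sharing a vertex; it is acyclic if every matched edge has invertible coefficient and the directed graph obtained by reversing all matched edges has no directed cycle. Critical basis elements are those not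 incident to any matched edge. *)

(* Defs.v *)
From HB Require Import structures.
From mathcomp Require Import all_boot all_order all_algebra.

Set Implicit Arguments.
Unset Strict Implicit.
Unset Printing Implicit Defensive.

Import GRing.Theory.
Local Open Scope ring_scope.

(* A simple graph on V is given by its set E of edges, each a two-element set
   of vertices; a spanning subgraph is a set F of edges. *)
Definition adj (V : finType) (F : {set {set V}}) : rel V :=
  fun x y => [set x; y] \in F.

Definition comps (V : finType) (F : {set {set V}}) : {set {set V}} :=
  equivalence_partition (connect (adj F)) [set: V].

Definition connected_graph (V : finType) (F : {set {set V}}) : bool :=
  [forall x, forall y, connect (adj F) x y].

(* The bound k <= #|V| loses nothing, since the vertices of p are distinct. *)
Definition cycle_edges (V : finType) (E C : {set {set V}}) : bool :=
  [exists k : 'I_#|V|.+1, exists p : k.-tuple V,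
    [&& (2 < k)%N, uniq p, cycle (adj E) p
      & C == [set [set x; next p x] | x in p]]].

Definition broken_circuit (V : finType) (E : {set {set V}}) (le : rel {set V})
    (B : {set {set V}}) : bool :=
  [exists C : {set {set V}}, cycle_edges E C &&
    [exists e in C, [forall f in C, le e f] && (B == C :\ e)]].

Definition nbc (V : finType) (E : {set {set V}}) (le : rel {set V})
    (F : {set {set V}}) : bool :=
  [forall B, broken_circuit E le B ==> ~~ (B \subset F)].

Definition spanning_tree (V : finType) (E T : {set {set V}}) : bool :=
  [&& T \subset E, connected_graph T & ~~ [exists C, cycle_edges T C]].

Definition nbc_tree (V : finType) (E : {set {set V}}) (le : rel {set V})
    (T : {set {set V}}) : bool :=
  spanning_tree E T && nbc E le T.

(* The label x^i of a component, i.e. 1 or x, is encoded by its exponent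
   i : 'I_2.  A labelling of the components of F is a function on all vertex
   sets, normalised to 0 on those that are not components. *)
Definition labelling (V : finType) := {ffun {set V} -> 'I_2}.

Definition is_state (V : finType) (E : {set {set V}})
    (s : {set {set V}} * labelling V) : bool :=
  (s.1 \subset E) && [forall C, (C \notin comps s.1) ==> (s.2 C == ord0)].

Definition state (V : finType) (E : {set {set V}}) := {s | is_state E s}.

(* The components of F containing an endpoint of e: two of them if e merges
   components, one otherwise. *)
Definition touched (V : finType) (F : {set {set V}}) (e : {set V}) :
    {set {set V}} :=
  [set C in comps F | ~~ [disjoint C & e]].

(* The labelling eps_e, or None if the product of the two merged labels is 0:
   in Z[x]/(x^2), x^i * x^j is x^(i + j) if i + j < 2, and 0 otherwise. *)
Definition relabel (V : finType) (F : {set {set V}}) (eps : labelling V)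
    (e : {set V}) : option (labelling V) :=
  if #|touched F e| == 2%N then
    if insub (\sum_(C in touched F e) eps C)%N is Some a then
      Some [ffun D : {set V} =>
              if D == cover (touched F e) then a
              else if D \in touched F e then ord0 else eps D]
    else None
  else Some eps.

Definition add_edge (V : finType) (s : {set {set V}} * labelling V)
    (e : {set V}) : option ({set {set V}} * labelling V) :=
  omap (pair (e |: s.1)) (relabel s.1 s.2 e).

Definition edge_sign (V : finType) (le : rel {set V}) (F : {set {set V}})
    (e : {set V}) : int :=
  (-1) ^+ #|[set e' in F | (e' != e) && le e' e]|.

Lemma adj_sym (V : finType) (F : {set {set V}}) : symmetric (adj F).
Proof. by move=> x y; rewrite /adj setUC. Qed.

Lemma compsP (V : finType) (F : {set {set V}}) (C : {set V}) :
  reflect (exists x, C = [set y | connect (adj F) x y]) (C \in comps F).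
Proof.
apply: (iffP imsetP) => [[x _ ->] | [x ->]]; exists x => //;
  by apply/setP=> y; rewrite !inE.
Qed.

Lemma connect_adjU (V : finType) (F : {set {set V}}) (e : {set V}) x y :
  connect (adj F) x y -> connect (adj (e |: F)) x y.
Proof.
apply: connect_sub => a b ab; apply: connect1.
by rewrite /adj in_setU1; apply/orP; right.
Qed.

Lemma comps_untouched (V : finType) (F : {set {set V}}) (e C : {set V}) :
  C \in comps F -> C \notin touched F e -> C \in comps (e |: F).
Proof.
move=> CF; rewrite inE CF /= negbK => dCe.
have /compsP [x defC] := CF; apply/compsP; exists x.
have clC : closed (adj (e |: F)) C.
  move=> a b; rewrite /adj in_setU1 => /orP[/eqP abe | abF].
    have -> : (a \in C) = false by rewrite (disjointFl dCe) // -abe set21.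
    by rewrite (disjointFl dCe) // -abe set22.
  rewrite defC !inE; apply/idP/idP => H; apply: connect_trans H (connect1 _) => //.
  by rewrite adj_sym.
apply/setP=> y; rewrite inE; apply/idP/idP => [|xy].
  by rewrite defC inE => /(connect_adjU e).
by rewrite -(closed_connect clC xy) defC inE connect0.
Qed.

Lemma comps_merged (V : finType) (F : {set {set V}}) (e : {set V}) :
  #|e| = 2%N -> cover (touched F e) \in comps (e |: F).
Proof.
move/eqP/cards2P => [u [v [_ defe]]]; set U := cover _.
have inU a b : connect (adj F) a b -> b \in e -> a \in U.
  move=> ab be; apply/bigcupP; exists [set y | connect (adj F) a y].
    rewrite inE; apply/andP; split; first by apply/compsP; exists a.
    by apply/pred0Pn; exists b; rewrite /= inE ab be.
  by rewrite inE connect0.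
have Uin a : a \in U -> exists2 b, b \in e & connect (adj F) a b.
  case/bigcupP=> C; rewrite inE => /andP[/compsP[x ->] /pred0Pn[b /andP[]]].
  rewrite /= !inE => xb be xa; exists b => //.
  by apply: connect_trans xb; rewrite (sym_connect_sym (@adj_sym _ F)).
have clU : closed (adj (e |: F)) U.
  have symF' : connect_sym (adj (e |: F)).
    by apply/sym_connect_sym/adj_sym.
  apply: intro_closed => // a b; rewrite /adj in_setU1 => /orP[/eqP abe | abF].
    by move=> _; apply: (inU b b) => //; rewrite -abe set22.
  case/Uin=> c ce ac; apply: inU ce; apply: connect_trans ac.
  by apply: connect1; rewrite adj_sym.
apply/compsP; exists u; apply/setP=> y; rewrite inE; apply/idP/idP => [|uy].
  case/Uin=> c; rewrite defe !inE => /orP[]/eqP-> yc;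
    rewrite (sym_connect_sym (@adj_sym _ _)).
    exact: connect_adjU.
  apply: connect_trans (connect_adjU _ yc) (connect1 _).
  by rewrite /adj setUC in_setU1 eqxx.
rewrite -(closed_connect clU uy); apply: (inU u u) => //.
by rewrite defe set21.
Qed.

Lemma touched_card (V : finType) (F : {set {set V}}) (e : {set V}) :
  #|e| = 2%N -> #|touched F e| = 1%N \/ #|touched F e| = 2%N.
Proof.
move=> e2.
have le2 : (#|touched F e| <= 2)%N.
  rewrite -e2; apply: leq_trans (leq_imset_card (fun b => [set y | connect (adj F) b y]) e).
  apply: subset_leq_card; apply/subsetP=> C.
  rewrite inE => /andP[/compsP[x ->] /pred0Pn[b /andP[]]].
  rewrite /= inE => xb be; apply/imsetP; exists b => //.
  apply/setP=> y; rewrite !inE.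
  exact: (same_connect (sym_connect_sym (@adj_sym _ F)) xb).
have gt0 : (0 < #|touched F e|)%N.
  have /card_gt0P [b be] : (0 < #|e|)%N by rewrite e2.
  apply/card_gt0P; exists [set y | connect (adj F) b y].
  rewrite inE; apply/andP; split; first by apply/compsP; exists b.
  by apply/pred0Pn; exists b; rewrite /= inE connect0 be.
by case: #|_| le2 gt0 => [|[|[|]]] // _ _; [left | right].
Qed.

(* chrom_d therefore loses no term: add_edge only produces enhanced states. *)
Lemma add_edge_state (V : finType) (E : {set {set V}})
    (s t : {set {set V}} * labelling V) (e : {set V}) :
  is_state E s -> e \in E -> #|e| = 2%N -> add_edge s e = Some t ->
  is_state E t.
Proof.
case: s => F eps /andP[/= sFE /forallP H] eE e2.
have {}H D : D \notin comps F -> eps D = ord0.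
  by move=> DF; move/implyP: (H D) => /(_ DF) /eqP.
have sub : e |: F \subset E by rewrite subUset sub1set eE.
have un D : D \notin comps (e |: F) -> D \notin touched F e -> eps D = ord0.
  move=> D' nT; apply: H; apply: contra D' => DF; exact: comps_untouched.
rewrite /add_edge /relabel /=; case: eqP => [_ | n2].
  case: insubP => //= a _ _ [<-]; rewrite /is_state /= sub /=.
  apply/forallP=> D; apply/implyP=> D'; rewrite ffunE.
  have [DU | _] := eqVneq D (cover _); first by rewrite DU comps_merged in D'.
  by case: ifP => // /negbT /(un _ D') ->.
case=> <-; rewrite /is_state /= sub /=.
apply/forallP=> D; apply/implyP=> D'; apply/eqP/un => //.
have [/eqP/cards1P [C tC] | //] := touched_card F e2.
apply: contra D' => DT; move: (comps_merged F e2); rewrite tC /cover big_set1.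
by move: DT; rewrite tC inE => /eqP->.
Qed.

(* The image d(s) of a basis element s, as a finitely supported family of
   integer coefficients. *)
Definition chrom_d (V : finType) (E : {set {set V}}) (le : rel {set V})
    (s : state E) : {ffun state E -> int} :=
  [ffun t => \sum_(e in E :\: (val s).1 | add_edge (val s) e == Some (val t))
               edge_sign le (val s).1 e].

Definition nbc_state (V : finType) (E : {set {set V}}) (le : rel {set V}) :=
  {s : state E | nbc E le (val s).1}.

Definition nbc_d (V : finType) (E : {set {set V}}) (le : rel {set V})
    (s : nbc_state E le) : {ffun nbc_state E le -> int} :=
  [ffun t => chrom_d le (val s) (val t)].

Definition lin_ext (Omega : finType) (f : Omega -> {ffun Omega -> int})
    (z : {ffun Omega -> int}) : {ffun Omega -> int} :=
  [ffun c' => \sum_c z c * f c c'].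

Definition nbc_diff (V : finType) (E : {set {set V}}) (le : rel {set V}) :
    {ffun nbc_state E le -> int} -> {ffun nbc_state E le -> int} :=
  lin_ext (@nbc_d V E le).

Definition gen (Omega : finType) (c : Omega) : {ffun Omega -> int} :=
  [ffun c' => (c' == c)%:R].

Definition coef (Omega : finType)
    (d : {ffun Omega -> int} -> {ffun Omega -> int}) (c c' : Omega) : int :=
  d (gen c) c'.

Definition hasse (Omega : finType)
    (d : {ffun Omega -> int} -> {ffun Omega -> int}) : rel Omega :=
  fun c c' => coef d c c' != 0.

Definition matching (Omega : finType)
    (d : {ffun Omega -> int} -> {ffun Omega -> int})
    (M : {set Omega * Omega}) : Prop :=
  (forall p, p \in M -> hasse d p.1 p.2) /\
  (forall p q, p \in M -> q \in M -> p != q ->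
     [disjoint [set p.1; p.2] & [set q.1; q.2]]).

Definition reversed (Omega : finType)
    (d : {ffun Omega -> int} -> {ffun Omega -> int})
    (M : {set Omega * Omega}) : rel Omega :=
  fun c c' => (hasse d c c' && ((c, c') \notin M)) || ((c', c) \in M).

Definition acyclic_matching (Omega : finType)
    (d : {ffun Omega -> int} -> {ffun Omega -> int})
    (M : {set Omega * Omega}) : Prop :=
  [/\ matching d M,
      (forall p, p \in M -> coef d p.1 p.2 \is a GRing.unit)
    & (forall s : seq Omega, cycle (reversed d M) s -> s = [::])].

Definition critical (Omega : finType) (M : {set Omega * Omega}) (c : Omega) :
    bool :=
  [forall p in M, (c != p.1) && (c != p.2)].

Lemma coef_nbc_diff (V : finType) (E : {set {set V}}) (le : rel {set V})
    (s t : nbc_state E le) :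
  coef (@nbc_diff V E le) s t = chrom_d le (val s) (val t).
Proof.
rewrite /coef ffunE (bigD1 s) //= ffunE eqxx mul1r ffunE big1 ?addr0 // => c.
by move=> /negbTE cs; rewrite ffunE cs mul0r.
Qed.

(* Main.v *)
(* Process the edges from the largest to the smallest, deleting those that
   are not in F. Call e a bridge of F if its ends get disconnected when it
   is removed in its turn; whether e is a bridge depends only on the edges
   of F above e. Adding a bridge to an NBC set never creates a broken
   circuit, and F together with its bridges is an NBC spanning tree, in
   which every bridge has an end far from the root. Match an enhanced state
   by adding or removing its largest bridge e such that e belongs to F or
   the component of F at the far end of e is labelled 1. The critical states
   are those for which no bridge belongs to F and every component but that
   of the root is labelled x. Such a state is determined by the label of the
   root component and by the tree T = F + bridges, since the bridges of T
   are those of F.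

   The matching is acyclic: on a cycle let e be the largest edge that
   varies. The number of components labelled x on the far side of e cannot
   increase, hence is constant, so e is only ever added to a far component
   labelled 1; the next step removes e again and leads back to the same
   state. *)

Require Import Defs.
From mathcomp Require Import all_boot all_algebra.

Set Implicit Arguments.
Unset Strict Implicit.
Unset Printing Implicit Defensive.

(** * Connectivity and circuits *)

Section Connectivity.

Variable V : finType.
Implicit Types (A N : {set V}) (F G C : {set {set V}}) (e f : {set V}).
Implicit Types (u v w x y : V).

Definition component F v : {set V} := [set w | connect (adj F) v w].

Lemma sym_connect_adj F : connect_sym (adj F).
Proof. exact/sym_connect_sym/adj_sym. Qed.

Lemma connect_adj1 F u v : [set u; v] \in F -> connect (adj F) u v.
Proof. exact: connect1. Qed.

Lemma connect_adjS F G x y :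
  F \subset G -> connect (adj F) x y -> connect (adj G) x y.
Proof.
move=> sFG; apply: connect_sub => a b abF; apply: connect_adj1.
exact: (subsetP sFG).
Qed.

Lemma in_component F v w : (w \in component F v) = connect (adj F) v w.
Proof. by rewrite inE. Qed.

Lemma mem_component F v : v \in component F v.
Proof. by rewrite inE. Qed.

Lemma component_comps F v : component F v \in comps F.
Proof. by apply/compsP; exists v. Qed.

Lemma componentS F G v : F \subset G -> component F v \subset component G v.
Proof. by move=> sFG; apply/subsetP=> w; rewrite !inE; apply: connect_adjS. Qed.

Lemma eq_component F u v :
  (component F u == component F v) = connect (adj F) u v.
Proof.
apply/eqP/idP => [/setP/(_ v)|uv]; first by rewrite !inE connect0.
by apply/setP=> w; rewrite !inE (same_connect (sym_connect_adj F) uv).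
Qed.

Definition hull F A : {set V} := \bigcup_(v in A) component F v.

Lemma hull_component F G w : F \subset G ->
  hull G (component F w) = component G w.
Proof.
move=> sFG; apply/setP=> x; apply/bigcupP/idP => [[y]|wx].
  by rewrite !inE => /(connect_adjS sFG); apply: connect_trans.
by exists w; rewrite ?mem_component.
Qed.

Lemma closed_component_sub F N w :
  closed (adj F) N -> (component F w \subset N) = (w \in N).
Proof.
move=> clN; apply/subsetP/idP => [|wN v]; first by apply; apply: mem_component.
by rewrite in_component => /(closed_connect clN) <-.
Qed.

Lemma connect_leave F N x y : connect (adj F) x y -> x \in N -> y \notin N ->
  exists u v, [/\ [set u; v] \in F, u \in N & v \notin N].
Proof.
move=> xy xN yN.
have [/existsP[u /existsP[v /and3P[]]] | no_exit] := boolP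
    [exists u, exists v, [&& [set u; v] \in F, u \in N & v \notin N]].
  by exists u, v.
have clN : closed (adj F) N.
  apply: intro_closed => [|u v uvF uN]; first exact: sym_connect_adj.
  apply: contraR no_exit => vN.
  by apply/existsP; exists u; apply/existsP; exists v; apply/and3P.
by rewrite -(closed_connect clN xy) xN in yN.
Qed.

Lemma connect_exit F N x y : connect (adj F) x y -> x \in N -> y \notin N ->
  exists u v,
    [/\ [set u; v] \in F, connect (adj (F ::&: N)) x u & v \notin N].
Proof.
move=> xy xN yN; have sCN : component (F ::&: N) x \subset N.
  apply/subsetP=> w; rewrite inE => xw; apply: contraT => wN.
  have [u [v [uvF _]]] := connect_leave xw xN wN.
  by case/setIdP: uvF => _ /subsetP->; rewrite ?set22.
have [|u [v [uvF]]] := connect_leave xy (mem_component (F ::&: N) x).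
  by apply: contra yN; apply: (subsetP sCN).
rewrite !inE => xu xv; exists u, v; split=> //; apply: contra xv => vN.
apply: (connect_trans xu (connect_adj1 _)); rewrite inE uvF subUset !sub1set vN.
by rewrite (subsetP sCN) ?inE.
Qed.

Lemma connect_inside F x y : connect (adj F) x y ->
  connect (adj (F ::&: component F x)) x y.
Proof.
move=> xy; apply: contraT => nxy; set I := _ ::&: _ in nxy *.
have yI : y \notin component I x by rewrite inE.
have [u [v [uvF]]] := connect_leave xy (mem_component I x) yI.
have sIF : I \subset F by apply/subsetP=> e /setIdP[].
rewrite !in_component => xu /negP[].
have xuF := connect_adjS sIF xu.
have xvF := connect_trans xuF (connect_adj1 uvF).
apply: (connect_trans xu (connect_adj1 _)).
by rewrite inE uvF subUset !sub1set !in_component xuF.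
Qed.

Lemma connect_setU1 F u v x y : connect (adj ([set u; v] |: F)) x y ->
  [\/ connect (adj F) x y, connect (adj F) x u /\ connect (adj F) v y
    | connect (adj F) x v /\ connect (adj F) u y].
Proof.
have leave_end a b : connect (adj ([set u; v] |: F)) a b ->
    ~~ connect (adj F) a b -> connect (adj F) a u \/ connect (adj F) a v.
  move=> ab nab; have bC : b \notin component F a by rewrite inE.
  have [c [d []]] := connect_leave ab (mem_component F a) bC.
  rewrite in_setU1 !inE => /predU1P[cd_uv | cdF] ac; last first.
    by rewrite (connect_trans ac (connect_adj1 cdF)).
  by have := set21 c d; rewrite cd_uv => /set2P[<- | <-]; [left | right].
move=> xy; have [|nxy] := boolP (connect (adj F) x y); first by constructor 1.
have nyx : ~~ connect (adj F) y x by rewrite sym_connect_adj.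
have yx := xy; rewrite sym_connect_adj in yx.
have := leave_end _ _ yx nyx; rewrite ![connect _ y _]sym_connect_adj.
case: (leave_end _ _ xy nxy) => [xu|xv] [uy|vy].
- by rewrite (connect_trans xu uy) in nxy.
- by constructor 2.
- by constructor 3.
- by rewrite (connect_trans xv vy) in nxy.
Qed.

(* Closure in the graphic matroid. *)
Definition spans G e := [forall u in e, forall v in e, connect (adj G) u v].

Lemma spans2 G u v : spans G [set u; v] = connect (adj G) u v.
Proof.
apply/forall_inP/idP => [/(_ u (set21 u v))/forall_inP|uv x].
  by apply; rewrite set22.
case/set2P=> ->; apply/forall_inP=> y /set2P[] -> //.
by rewrite sym_connect_adj.
Qed.

Lemma spansS F G e : F \subset G -> spans F e -> spans G e.
Proof.
move=> sFG /forall_inP spF; apply/forall_inP=> u ue.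
apply/forall_inP=> v ve; exact: connect_adjS sFG (forall_inP (spF u ue) v ve).
Qed.

Lemma spans_exchange G e f : #|e| = 2 -> #|f| = 2 ->
  spans (f |: G) e -> ~~ spans G e -> spans (e |: G) f.
Proof.
move=> /eqP/cards2P[x [y [_ ->]]] /eqP/cards2P[u [v [_ ->]]]; rewrite !spans2.
have yx : connect (adj ([set x; y] |: G)) y x.
  by rewrite sym_connect_adj connect_adj1 ?setU11.
case/connect_setU1=> [-> // | [xu vy] | [xv uy]] _.
  rewrite sym_connect_adj; apply: connect_trans (connect_adjU _ vy) _.
  exact: connect_trans yx (connect_adjU _ xu).
apply: connect_trans (connect_adjU _ uy) _.
exact: connect_trans yx (connect_adjU _ xv).
Qed.

Lemma cycle_edges_sub F C : cycle_edges F C -> C \subset F.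
Proof.
case/existsP=> k /existsP[p /and4P[_ _ cycle_p /eqP->]].
apply/subsetP=> e /imsetP[x xp ->]; exact: (next_cycle cycle_p xp).
Qed.

Lemma cycle_edgesS F G C : F \subset G -> cycle_edges F C -> cycle_edges G C.
Proof.
move=> sFG /existsP[k /existsP[p /and4P[k_gt2 uniq_p cycle_p defC]]].
apply/existsP; exists k; apply/existsP; exists p.
rewrite k_gt2 uniq_p defC andbT.
by apply: sub_cycle cycle_p => a b; apply: (subsetP sFG).
Qed.

Lemma cycle_edges_neq0 F C : cycle_edges F C -> C != set0.
Proof.
case/existsP=> k /existsP[p /and4P[k_gt2 _ _ /eqP->]].
set x := tnth p (Ordinal (ltnW (ltnW k_gt2))).
apply/set0Pn; exists [set x; next p x].
by apply: (imset_f (fun y => [set y; next p y])); apply: mem_tnth.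
Qed.

Lemma next_edge_inj (p : seq V) : uniq p -> 2 < size p ->
  {in p &, injective (fun x => [set x; next p x])}.
Proof.
move=> uniq_p p_gt2 x y xp yp edge_xy; apply: contraTeq p_gt2 => xNy.
have next_yx : next p y = x.
  by move: (set21 x (next p x)); rewrite edge_xy !inE (negPf xNy) => /eqP.
have next_xy : next p x = y.
  move: (set21 y (next p y)).
  by rewrite -edge_xy !inE eq_sym (negPf xNy) => /eqP.
rewrite -(order_cycle (cycle_next uniq_p) uniq_p xp); apply/negP=> order_gt2.
by have := findex_iter order_gt2; rewrite /= next_xy next_yx findex0.
Qed.

Lemma cycle_edges_spans F C e : cycle_edges F C -> e \in C -> spans (C :\ e) e.
Proof.
case/existsP=> k /existsP[p /and4P[k_gt2 uniq_p _ /eqP->]] /imsetP[x xp ->].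
have p_gt2 : 2 < size p by rewrite size_tuple.
rewrite spans2 sym_connect_adj; set D := _ :\ _; set y := next p x.
apply: contraT => nyx; have along n : iter n (next p) y \in (p : seq V)
    /\ connect (adj D) y (iter n (next p) y).
  elim: n => [|n [zp yz]] /=; first by rewrite mem_next xp connect0.
  set z := iter n _ _ in zp yz *; rewrite mem_next zp; split=> //.
  have zNx : z != x by apply: contraNneq nyx => <-.
  apply: connect_trans yz (connect_adj1 _); rewrite in_setD1.
  rewrite (imset_f (fun w => [set w; next p w]) zp) andbT.
  by apply: contraNneq zNx => /(next_edge_inj uniq_p p_gt2 zp xp) ->.
have yp : y \in (p : seq V) by rewrite mem_next.
have yx : fconnect (next p) y x.
  by rewrite (fconnect_cycle (cycle_next uniq_p) yp).
by have [_] := along (findex (next p) y x); rewrite iter_findex // (negPf nyx).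
Qed.

End Connectivity.

(** * Enhanced states *)

Section EnhancedStates.

Variables (V : finType) (E : {set {set V}}).
Implicit Types (F : {set {set V}}) (X : {set V}) (u v w : V).
Implicit Types s t : {set {set V}} * labelling V.

(* An enhanced state is recovered from its edge set and the set of vertices
   lying in components labelled x. *)
Definition xset s : {set V} := [set v | s.2 (component s.1 v) != ord0].

Lemma xset_connect s u v :
  connect (adj s.1) u v -> (u \in xset s) = (v \in xset s).
Proof. by rewrite -eq_component !inE => /eqP->. Qed.

Lemma neq_ord0_inj : injective (fun i : 'I_2 => i != ord0).
Proof. by move=> [[|[|i]] ?] [[|[|j]] ?] //= _; apply: val_inj. Qed.

Lemma state_ext s t :
  is_state E s -> is_state E t -> s.1 = t.1 -> xset s = xset t -> s = t.
Proof.
case: s t => F eps [G eta].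
move=> /andP[_ /forallP/= eps0] /andP[_ /forallP/= eta0] /= eqFG.
rewrite -{}eqFG in eta0 * => /setP eqX; congr pair; apply/ffunP=> C.
have [/compsP[v ->] | CF] := boolP (C \in comps F).
  by apply: neq_ord0_inj; have := eqX v; rewrite !inE /=.
by rewrite (eqP (implyP (eps0 C) CF)) (eqP (implyP (eta0 C) CF)).
Qed.

Definition mk_state F X : {set {set V}} * labelling V :=
  (F, [ffun C => if (C \in comps F) && (C \subset X) then ord_max else ord0]).

Lemma is_state_mk_state F X : F \subset E -> is_state E (mk_state F X).
Proof.
move=> sFE; apply/andP; split=> //; apply/forallP=> C; apply/implyP=> /= CF.
by rewrite ffunE (negPf CF).
Qed.

Lemma xset_mk_state F X : closed (adj F) X -> xset (mk_state F X) = X.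
Proof.
move=> clX; apply/setP=> v; rewrite inE ffunE component_comps /=.
by rewrite closed_component_sub //; case: (v \in X).
Qed.

Lemma component_setU1 F u v w : component ([set u; v] |: F) w =
  if w \in component F u :|: component F v
  then component F u :|: component F v else component F w.
Proof.
set e := [set u; v]; set U := component F u :|: component F v.
have uv : connect (adj (e |: F)) u v by apply: connect_adj1; apply: setU11.
have connU a : a \in U -> connect (adj (e |: F)) u a.
  rewrite !inE => /orP[] /(connect_adjU e) //; exact: connect_trans uv.
have closedU a b : a \in U -> connect (adj (e |: F)) a b -> b \in U.
  move=> aU ab; have := connect_trans (connU a aU) ab.
  rewrite !inE => /connect_setU1[-> //|[_ ->]|[_ ->] //]; exact: orbT.
apply/setP=> a; rewrite inE; case: ifP => wU; apply/idP/idP.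
- exact: closedU.
- by move=> /connU; apply: connect_trans; rewrite sym_connect_adj connU.
- rewrite inE; case/connect_setU1 => // [[wu _] | [wv _]]; case/idP: wU.
    by rewrite !inE sym_connect_adj wu.
  by rewrite !inE ![connect _ _ w]sym_connect_adj wv orbT.
- by rewrite inE; apply: connect_adjU.
Qed.

Lemma touched2 F u v :
  touched F [set u; v] = [set component F u; component F v].
Proof.
apply/setP=> C; rewrite inE; apply/andP/set2P.
  case=> /compsP[w ->] /pred0Pn[a /andP[]] /=; rewrite inE -eq_component.
  by move=> /eqP wa /set2P[<- | <-]; [left | right].
case=> ->; split; rewrite ?component_comps //; apply/pred0Pn.
  by exists u; rewrite /= inE connect0 set21.
by exists v; rewrite /= inE connect0 set22.
Qed.

Lemma ltn_add_ord2 (i j : 'I_2) : (i + j < 2) = ~~ ((i != ord0) && (j != ord0)).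
Proof. by case: i j => [[|[|i]] ?] [[|[|j]] ?]. Qed.

Lemma add_edge_defined s u v :
    (u \in xset s -> v \in xset s -> connect (adj s.1) u v) ->
  exists t, add_edge s [set u; v] = Some t.
Proof.
case: s => F eps; rewrite !inE /add_edge /relabel /= touched2 cards2 => uv.
have [_ | neq_uv] := eqVneq (component F u); first by eexists.
rewrite big_setU1 ?inE //= big_set1; case: insubP => [a _ _|]; first by eexists.
rewrite ltn_add_ord2 negbK => /andP[/uv{}uv /uv].
by rewrite -eq_component (negPf neq_uv).
Qed.

Lemma add_edge_some s t u v (U := component s.1 u :|: component s.1 v) :
    add_edge s [set u; v] = Some t ->
  [/\ t.1 = [set u; v] |: s.1,
      u \in xset s -> v \in xset s -> connect (adj s.1) u v
    & forall w, (w \in xset t) =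
        (w \in xset s) || ((u \in xset s) || (v \in xset s)) && (w \in U)].
Proof.
case: s => F eps in U *; rewrite /add_edge /relabel /= touched2 cards2.
have [eq_uv | neq_uv] /= := eqVneq (component F u).
  case=> <-; split=> //= [_ _|w]; first by rewrite -eq_component eq_uv.
  have wUu : (w \in U) = (component F w == component F u).
    by rewrite /U -eq_uv setUid inE eq_component sym_connect_adj.
  rewrite wUu !inE component_setU1 -/U wUu /U -eq_uv setUid orbb /=.
  by have [->|_] := eqVneq (component F w); rewrite ?andbT ?orbb ?andbF ?orbF.
rewrite big_setU1 ?inE //= big_set1.
case: insubP => // a sum_lt2 val_a [<-] /=; split=> // [uX vX|w].
  by rewrite ltn_add_ord2 uX vX in sum_lt2.
have <- : (a != ord0) =
    (eps (component F u) != ord0) || (eps (component F v) != ord0).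
  by rewrite -val_eqE val_a addn_eq0 negb_and.
have coverU : cover [set component F u; component F v] = U.
  by rewrite /cover big_setU1 ?inE //= big_set1.
have touchedU :
    (component F w \in [set component F u; component F v]) = (w \in U).
  by rewrite in_set2 in_setU !inE !eq_component ![connect _ w _]sym_connect_adj.
rewrite inE /= ffunE coverU component_setU1 -/U.
have [wU | wU] := boolP (w \in U); last first.
  have -> : (component F w == U) = false.
    by apply: contraNF wU => /eqP <-; apply: mem_component.
  by rewrite touchedU (negPf wU) andbF orbF inE.
rewrite eqxx andbT inE /=; case: eqP => [a0|]; rewrite ?orbT ?orbF //.
move/esym/eqP: val_a; rewrite a0 addn_eq0 => /andP[/eqP eps_u /eqP eps_v].
move: wU; rewrite -touchedU -val_eqE.
by case/set2P=> ->; rewrite /= ?eps_u ?eps_v.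
Qed.

End EnhancedStates.

(** * Relations, cycles and matchings *)

Lemma exists_maximum (T : finType) (E A : {set T}) (r : rel T) :
    {in E &, total r} -> {in E & &, transitive r} -> A \subset E -> A != set0 ->
  exists2 e, e \in A & forall f, f \in A -> r f e.
Proof.
move=> r_total r_trans sAE /set0Pn[a aA]; have AE := subsetP sAE.
pose below e := #|[set f in A | r f e]|.
case: (@arg_maxnP _ a [in A] below aA) => e eA max_e.
exists e => // f fA; apply: contraT => nfe.
have /orP[|ef] := r_total f e (AE f fA) (AE e eA); first by rewrite (negPf nfe).
suff /proper_card : [set g in A | r g e] \proper [set g in A | r g f].
  by rewrite ltnNge => /negP[]; exact: max_e.
apply/properP; split.
  apply/subsetP=> g /setIdP[gA ge]; rewrite inE gA.
  exact: (r_trans e g f) (AE e eA) (AE g gA) (AE f fA) ge ef.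
exists f; rewrite inE fA //=.
by have /orP[] := r_total f f (AE f fA) (AE f fA).
Qed.

Lemma cycle_not_rel (K : eqType) (r R : rel K) (c : seq K) x y :
    transitive R -> cycle r c -> x \in c -> y \in c -> ~~ R x y ->
  exists a b, [/\ a \in c, b \in c, r a b & ~~ R a b].
Proof.
move=> R_trans cycle_c xc yc nRxy.
have [/hasP[a ac /hasP[b bc /andP[rab nRab]]] | no_step] :=
    boolP (has (fun a => has (fun b => r a b && ~~ R a b) c) c).
  by exists a, b.
suff : cycle R c.
  by rewrite cycle_all2rel // => /allrelP/(_ x y xc yc); rewrite (negPf nRxy).
apply: (@sub_in_cycle _ (mem c) r) cycle_c; last exact/allP.
move=> a b ac bc rab; apply: contraR no_step => nRab.
by apply/hasP; exists a => //; apply/hasP; exists b => //; rewrite rab.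
Qed.

Section DiscreteMorse.

Variables (Omega : finType) (d : {ffun Omega -> int} -> {ffun Omega -> int}).
Variable M : {set Omega * Omega}.
Implicit Types r s t u : Omega.

Lemma matching_intro :
    (forall s t, (s, t) \in M -> hasse d s t) ->
    (forall s t u, (s, t) \in M -> (s, u) \in M -> t = u) ->
    (forall s t u, (s, u) \in M -> (t, u) \in M -> s = t) ->
    (forall s t u, (s, t) \in M -> (t, u) \notin M) ->
  matching d M.
Proof.
move=> hasse_M up_inj down_inj no_path; split=> [[s t] /hasse_M //|].
move=> [s t] [u v] stM uvM /eqP neq.
rewrite -setI_eq0; apply/eqP/setP=> w; rewrite !inE /=; apply/negP.
case/andP=> /orP[]/eqP-> /orP[]/eqP eq_w; rewrite {}eq_w in stM neq.
- by case: neq; rewrite (up_inj _ _ _ stM uvM).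
- by have := no_path _ _ t uvM; rewrite stM.
- by have := no_path _ _ v stM; rewrite uvM.
- by case: neq; rewrite (down_inj _ _ _ stM uvM).
Qed.

Variable rank : Omega -> nat.
Hypothesis matching_M : matching d M.
Hypothesis graded : forall s t, hasse d s t -> rank t = (rank s).+1.

Lemma matching_no_path s t u : (s, t) \in M -> (t, u) \notin M.
Proof.
case: matching_M => hasse_M disj_M stM; apply/negP=> tuM.
have neq : (s, t) != (t, u).
  apply/eqP=> -[eq_st _]; have := graded (hasse_M _ stM).
  by rewrite eq_st /= => /n_Sn.
have := disj_M _ _ stM tuM neq; rewrite -setI_eq0 => /eqP/setP/(_ t).
by rewrite !inE !eqxx orbT.
Qed.

(* The rank, raised by 1 at the elements that are not upper ends of matched
   edges, never decreases along reversed edges, hence is constant on a cycle. *)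
Lemma reversed_cycle_alternates c s t u :
    cycle (reversed d M) c -> s \in c -> t \in c -> u \in c ->
  hasse d s t -> reversed d M t u -> (u, t) \in M.
Proof.
move=> cycle_c sc tc uc hasse_st; pose upper x := [exists y, (y, x) \in M].
pose height x := rank x + ~~ upper x.
have height_le x y : reversed d M x y -> height x <= height y.
  case/orP=> [/andP[/graded rank_y _] | yxM].
    rewrite /height rank_y (leq_trans _ (leq_addr _ _)) //.
    by rewrite -addn1 leq_add2l leq_b1.
  have upper_x : upper x by apply/existsP; exists y.
  have upperNy : ~~ upper y.
    by apply/existsPn=> z; apply: contraL yxM; apply: matching_no_path.
  have rank_x := graded (proj1 matching_M _ yxM).
  by rewrite /height upper_x upperNy rank_x addn0 addn1.
have height_const x y : x \in c -> y \in c -> height x <= height y.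
  move=> xc yc; apply: contraT => height_yx.
  have height_trans : transitive (fun a b => height a <= height b).
    by move=> b a z; apply: leq_trans.
  have [a [b [_ _ /height_le ab]]] :=
    cycle_not_rel height_trans cycle_c xc yc height_yx.
  by rewrite ab.
have upper_t : upper t.
  have := height_const t s tc sc; rewrite /height (graded hasse_st).
  by case: (upper t) => //; rewrite leqNgt addSnnS ltn_add2l; case: (upper s).
case/orP=> // /andP[/graded rank_u _].
have := height_const u t uc tc; rewrite /height rank_u upper_t addn0.
by rewrite leqNgt (leq_trans _ (leq_addr _ _)).
Qed.

End DiscreteMorse.

(** * Bridges of an edge set *)

Section NbcComplex.

Variables (V : finType) (E : {set {set V}}) (le : rel {set V}).
Hypothesis simpleE : forall e : {set V}, e \in E -> #|e| = 2.
Hypothesis le_total : {in E &, total le}.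
Hypothesis le_anti : {in E &, antisymmetric le}.
Hypothesis le_trans : {in E & &, transitive le}.

Implicit Types (F S T C : {set {set V}}) (D N X e f g : {set V}).
Implicit Types (u v w x y z : V) (r s t : nbc_state E le).

Local Notation d := (@nbc_diff V E le).

Lemma le_refl_in e : e \in E -> le e e.
Proof. by move=> eE; have /orP[] := le_total eE eE. Qed.

Lemma le_antisym_in e f : e \in E -> f \in E -> le e f -> le f e -> e = f.
Proof. by move=> eE fE ef fe; apply: le_anti => //; rewrite ef. Qed.

Lemma exists_minimum S : S \subset E -> S != set0 ->
  exists2 e, e \in S & forall f, f \in S -> le e f.
Proof.
apply: (@exists_maximum _ _ _ (fun f g => le g f)).
  by move=> f g fE gE; apply: le_total.
by move=> f g h fE gE hE gf hg; apply: (le_trans fE hE gE).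
Qed.

(* What is left when the edges are processed from the largest down to e, those
   not in F being deleted, and e itself is removed. *)
Definition pruned F e : {set {set V}} :=
  [set f in E | (f != e) && (le f e || (f \in F))].

Definition bridges F : {set {set V}} := [set e in E | ~~ spans (pruned F e) e].

Definition completion F : {set {set V}} := F :|: bridges F.

Lemma in_completion F e :
  (e \in completion F) = (e \in F) || (e \in bridges F).
Proof. exact: in_setU. Qed.

Lemma bridges_sub F : bridges F \subset E.
Proof. by apply/subsetP=> e /setIdP[]. Qed.

Lemma bridge_edge F e : e \in bridges F -> e \in E.
Proof. exact/subsetP/bridges_sub. Qed.

Lemma completion_sub F : F \subset E -> completion F \subset E.
Proof. by move=> sFE; rewrite subUset sFE bridges_sub. Qed.

Lemma prunedS F T e : F \subset T -> pruned F e \subset pruned T e.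
Proof.
move=> sFT; apply/subsetP=> f; rewrite !inE.
case/and3P=> -> -> /= /orP[-> // | /(subsetP sFT) ->]; exact: orbT.
Qed.

Lemma subD1_pruned F e : F \subset E -> F :\ e \subset pruned F e.
Proof.
move=> sFE; apply/subsetP=> f /setD1P[fe fF].
by rewrite inE (subsetP sFE) // fe fF orbT.
Qed.

Lemma bridges_anti F T : F \subset T -> bridges T \subset bridges F.
Proof.
move=> sFT; apply/subsetP=> e /setIdP[eE]; rewrite inE eE /=.
exact/contra/spansS/prunedS.
Qed.

Definition agree_above e F T : Prop :=
  forall f, f \in E -> f != e -> le e f -> (f \in F) = (f \in T).

Lemma agree_above_le e f F T : e \in E -> f \in E -> le e f ->
  agree_above e F T -> agree_above f F T.
Proof.
move=> eE fE ef agr g gE gf fg; apply: agr (le_trans fE eE gE ef fg) => //.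
by apply: contraNneq gf => ge; apply/eqP/le_antisym_in => //; rewrite ge.
Qed.

Lemma pruned_agree e F T :
  e \in E -> agree_above e F T -> pruned F e = pruned T e.
Proof.
move=> eE agr; apply/setP=> f; rewrite !inE; have [fE | //] := boolP (f \in E).
have [// | fe] /= := eqVneq f e; have /orP[ef | -> //] := le_total eE fE.
by rewrite (agr f).
Qed.

Lemma bridges_agree e F T : e \in E -> agree_above e F T ->
  (e \in bridges F) = (e \in bridges T).
Proof. by move=> eE agr; rewrite !in_set (pruned_agree eE agr). Qed.

Lemma completion_agree e F T : e \in E ->
  agree_above e F T -> agree_above e (completion F) (completion T).
Proof.
move=> eE agr f fE fe ef; have agr_f := agree_above_le eE fE ef agr.
by rewrite !in_completion (agr f fE fe ef) (bridges_agree fE agr_f).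
Qed.

(* Remove the largest edge f of S: if adding it back made e spanned, then e, by
   exchange, would make f spanned, although f is a bridge above e. *)
Lemma setU_bridges_spansN F S e :
    e \in bridges F -> S \subset bridges F :\: F ->
    (forall f, f \in S -> le e f && (f != e)) ->
  ~~ spans (pruned F e :|: S) e.
Proof.
case/setIdP=> eE nspan_e; move: {2}#|S| (leqnn #|S|) => n.
elim: n S => [|n IHn] S.
  by rewrite leqn0 cards_eq0 => /eqP-> _ _; rewrite setU0.
have [-> | S_neq0] := eqVneq S set0; first by rewrite setU0.
move=> card_S sSB above_e; have sSE : S \subset E.
  exact: subset_trans sSB (subset_trans (subsetDl _ _) (bridges_sub F)).
have [f fS max_f] := exists_maximum le_total le_trans sSE S_neq0.
have fE := subsetP sSE f fS; have /andP[ef neq_fe] := above_e f fS.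
have /setDP[/setIdP[_ nspan_f] fNF] := subsetP sSB f fS.
have {}IHn : ~~ spans (pruned F e :|: S :\ f) e.
  apply: IHn; first by move: card_S; rewrite (cardsD1 f S) fS.
    exact: subset_trans (subsetDl _ _) sSB.
  by move=> g /setD1P[_ /above_e].
apply: contra nspan_f; rewrite -{1}(setD1K fS) setUCA => spans_e.
apply: spansS (spans_exchange (simpleE eE) (simpleE fE) spans_e IHn).
apply/subsetP=> g.
case/setU1P=> [-> | /setUP[/setIdP[gE /andP[neq_ge ge]] | /setD1P[neq_gf gS]]].
- by rewrite inE eE eq_sym neq_fe ef.
- have neq_gf : g != f.
    apply: contraNneq neq_ge => eq_gf; case/orP: ge => [ge|gF].
      by rewrite eq_gf; apply/eqP/le_antisym_in => //; rewrite -eq_gf.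
    by rewrite -eq_gf gF in fNF.
  rewrite inE gE neq_gf; case/orP: ge => [ge | ->]; rewrite ?orbT //.
  by rewrite (le_trans eE gE fE ge ef).
- by rewrite inE (subsetP sSE) // neq_gf max_f.
Qed.

Lemma bridges_completion F T :
  F \subset T -> T \subset completion F -> bridges T = bridges F.
Proof.
move=> sFT sTF; apply/eqP; rewrite eqEsubset bridges_anti //=.
apply/subsetP=> e eB; have eE := bridge_edge eB; rewrite inE eE /=.
pose S := [set f in T | [&& f \notin F, le e f & f != e]].
apply: contra (@setU_bridges_spansN F S e eB _ _).
- apply: spansS; apply/subsetP=> f /setIdP[fE /andP[fe]].
  rewrite !inE fE fe /= andbT; have [fF|fF] /= := boolP (f \in F).
    by rewrite orbT.
  by have /orP[-> | ->] := le_total eE fE; rewrite ?orbF ?andbT // orbC => ->.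
- apply/subsetP=> f /setIdP[fT /and3P[fF _ _]]; rewrite in_setD fF /=.
  by have := subsetP sTF f fT; rewrite in_setU (negPf fF).
- by move=> f /setIdP[_ /and3P[_ -> ->]].
Qed.

Lemma bridges_of_completion F : bridges (completion F) = bridges F.
Proof. by apply: bridges_completion; first exact: subsetUl. Qed.

Lemma bridge_completion_spansN F e : F \subset E -> e \in bridges F ->
  ~~ spans (completion F :\ e) e.
Proof.
move=> sFE; rewrite -bridges_of_completion => /setIdP[_].
exact/contra/spansS/subD1_pruned/completion_sub.
Qed.

Lemma nbcS F T : F \subset T -> nbc E le T -> nbc E le F.
Proof.
move=> sFT /forallP nbcT; apply/forallP=> B; apply/implyP=> B_broken.
by apply: contra (implyP (nbcT B) B_broken) => /subset_trans; apply.
Qed.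

Lemma circuit_bridgesN F C f e :
    cycle_edges E C -> (forall g, g \in C -> le f g) ->
  C :\ f \subset completion F -> e \in C :\ f -> e \notin bridges F.
Proof.
move=> circuit_C min_f sCF /setD1P[_ eC].
rewrite -bridges_of_completion inE negb_and negbK orbC.
rewrite (spansS _ (cycle_edges_spans circuit_C eC)) //.
apply/subsetP=> g /setD1P[ge gC].
rewrite inE (subsetP (cycle_edges_sub circuit_C)) // ge.
have [-> | gf] := eqVneq g f; first by rewrite min_f.
by rewrite (subsetP sCF) ?orbT // !inE gf.
Qed.

Lemma completion_nbc F : nbc E le F -> nbc E le (completion F).
Proof.
move/forallP=> nbcF; apply/forallP=> B; apply/implyP=> B_broken.
apply: contra (implyP (nbcF B) B_broken) => sBF; apply/subsetP=> e eB.
have /setUP[// | e_bridge] := subsetP sBF e eB.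
case/existsP: B_broken => C /andP[circuit_C].
case/exists_inP=> f fC /andP[/forall_inP min_f /eqP defB].
rewrite defB in eB sBF.
by have := circuit_bridgesN circuit_C min_f sBF eB; rewrite e_bridge.
Qed.

Lemma setU1_bridge_nbc F e : nbc E le F -> e \in bridges F -> nbc E le (e |: F).
Proof.
move=> nbcF eB; apply: nbcS (completion_nbc nbcF).
by rewrite subUset sub1set in_setU eB orbT subsetUl.
Qed.

Lemma nbc_acyclic T :
  T \subset E -> nbc E le T -> ~~ [exists C, cycle_edges T C].
Proof.
move=> sTE /forallP nbcT; apply/existsP=> -[C circuit_CT].
have circuit_C := cycle_edgesS sTE circuit_CT.
have [e eC min_e] :=
  exists_minimum (cycle_edges_sub circuit_C) (cycle_edges_neq0 circuit_C).
move/implyP: (nbcT (C :\ e)) => /(_ _)/negP[].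
  apply/existsP; exists C; rewrite circuit_C; apply/exists_inP; exists e => //.
  by rewrite eqxx andbT; apply/forall_inP.
exact: subset_trans (subsetDl _ _) (cycle_edges_sub circuit_CT).
Qed.

Lemma spanning_tree_bridges T : spanning_tree E T -> bridges T \subset T.
Proof.
case/and3P=> sTE /forallP conn_T _; apply/subsetP=> e /setIdP[eE].
apply: contraR => eT; apply: (@spansS _ T).
  by apply: subset_trans (subD1_pruned e sTE); rewrite subsetD1 subxx.
by apply/forall_inP=> u _; apply/forall_inP=> v _; apply: (forallP (conn_T u)).
Qed.

Lemma completion_setD_bridges T :
  spanning_tree E T -> completion (T :\: bridges T) = T.
Proof.
move=> treeT; have sBT := spanning_tree_bridges treeT.
have sTD : T \subset completion (T :\: bridges T).
  apply/subsetP=> e eT; rewrite in_setU in_setD eT andbT -implyNb negbK.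
  by apply/implyP/subsetP/bridges_anti/subsetDl.
rewrite /completion -(bridges_completion (subsetDl _ _) sTD).
by rewrite setUC -{1}(setIidPr sBT) setID.
Qed.

Lemma setD_completion_bridges F :
  [disjoint F & bridges F] -> completion F :\: bridges F = F.
Proof. by move=> dFB; rewrite setDUl setDv setU0; apply/setDidPl. Qed.

(** * The spanning tree and the far side of a bridge *)

Variable root : V.
Hypothesis connE : connected_graph E.

(* The smallest edge leaving a union of components is always a bridge. *)
Lemma bridges_sub_connected T : bridges T \subset T -> connected_graph T.
Proof.
move=> sBT; apply/forallP=> x; apply/forallP=> y; apply: contraT => nxy.
pose N := component T x; have yN : y \notin N by rewrite inE.
pose leaving := [set [set u; v] | u in N, v in ~: N] :&: E.
have mem_leaving u v : [set u; v] \in E -> u \in N -> v \notin N ->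
    [set u; v] \in leaving.
  move=> uvE uN vN; rewrite in_setI uvE andbT.
  by apply/imset2P; exists u v; rewrite ?in_setC.
have leaving_neq0 : leaving != set0.
  have xyE := forallP (forallP connE x) y.
  have [u [v [uvE uN vN]]] := connect_leave xyE (mem_component T x) yN.
  by apply/set0Pn; exists [set u; v]; apply: mem_leaving.
have leavingE : leaving \subset E := subsetIr _ _.
have [e /setIP[/imset2P[u v uN]]] := exists_minimum leavingE leaving_neq0.
rewrite inE => vN -> uvE min_uv {e}.
have leaveN a b : [set a; b] \in T -> a \in N -> b \in N.
  by rewrite !inE => abT xa; apply: connect_trans xa (connect_adj1 abT).
have uv_bridge : [set u; v] \in bridges T.
  rewrite inE uvE spans2; apply: contra vN => uv.
  apply: contraT => vN; have [a [b []]] := connect_leave uv uN vN.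
  rewrite inE => /and3P[abE /eqP neq_ab ab] aN bN.
  case/orP: ab => [ab | /leaveN/(_ aN)]; last by rewrite (negPf bN).
  by case: neq_ab; apply: le_antisym_in => //; apply/min_uv/mem_leaving.
by move: (leaveN u v (subsetP sBT _ uv_bridge) uN); rewrite (negPf vN).
Qed.

Lemma completion_connected F x y : connect (adj (completion F)) x y.
Proof.
suff /forallP/(_ x)/forallP/(_ y) : connected_graph (completion F) by [].
by apply: bridges_sub_connected; rewrite bridges_of_completion subsetUr.
Qed.

Lemma completion_nbc_tree F :
  F \subset E -> nbc E le F -> nbc_tree E le (completion F).
Proof.
move=> sFE nbcF; have nbc_compl := completion_nbc nbcF.
have sCE := completion_sub sFE.
rewrite /nbc_tree nbc_compl andbT /spanning_tree sCE nbc_acyclic // andbT.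
by apply: bridges_sub_connected; rewrite bridges_of_completion subsetUr.
Qed.

Definition far_side F e : {set V} := ~: component (completion F :\ e) root.

Definition far_end F e : {set V} := e :&: far_side F e.

Lemma in_far_side F e v :
  (v \in far_side F e) = ~~ connect (adj (completion F :\ e)) root v.
Proof. by rewrite !inE. Qed.

Lemma far_endP F e : F \subset E -> e \in bridges F ->
  exists y z, [/\ e = [set y; z], y \notin far_side F e, z \in far_side F e
                & far_end F e = [set z]].
Proof.
move=> sFE eB; have /eqP/cards2P[u [v [_ def_e]]] := simpleE (bridge_edge eB).
have uvN : ~~ connect (adj (completion F :\ e)) u v.
  by rewrite -spans2 -def_e; apply: bridge_completion_spansN.
have reach : connect (adj (completion F :\ e)) root u \/
             connect (adj (completion F :\ e)) root v.
  have eC : e \in completion F by rewrite in_setU eB orbT.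
  have := completion_connected F root u; rewrite -{1}(setD1K eC) {1}def_e.
  by case/connect_setU1 => [|[]|[]]; [left|left|right].
have far_end_of y z : e = [set y; z] ->
    connect (adj (completion F :\ e)) root y ->
    ~~ connect (adj (completion F :\ e)) y z ->
  [/\ y \notin far_side F e, z \in far_side F e & far_end F e = [set z]].
  move=> def_yz root_y yzN.
  have yN : y \notin far_side F e by rewrite in_far_side root_y.
  have zF : z \in far_side F e.
    rewrite in_far_side; apply: contra yzN; apply: connect_trans.
    by rewrite sym_connect_adj.
  split=> //; apply/setP=> w; rewrite in_setI {1}def_yz !in_set2 in_set1.
  have [-> | _] := eqVneq w z; first by rewrite orbT.
  by rewrite orbF; apply: contraNF yN => /andP[/eqP <-].
case: reach => [root_u | root_v]; [exists u, v | exists v, u].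
  by have [] := far_end_of u v def_e root_u uvN.
by have [||] := far_end_of v u _ root_v; rewrite 1?setUC // sym_connect_adj.
Qed.

Lemma far_side_pruned F e : F \subset E -> e \in bridges F ->
  far_side F e = ~: component (pruned (completion F) e) root.
Proof.
move=> sFE eB; congr (~: _); apply/eqP; rewrite eqEsubset.
have sDP := subD1_pruned e (completion_sub sFE); rewrite componentS //=.
have [y [z [def_e yNfar z_far _]]] := far_endP sFE eB.
have root_y : connect (adj (completion F :\ e)) root y.
  by move: yNfar; rewrite in_far_side negbK.
have : ~~ connect (adj (pruned (completion F) e)) y z.
  by move: eB; rewrite -bridges_of_completion -spans2 -def_e => /setIdP[].
apply: contraR => /subsetPn[w]; rewrite !inE => rw_pruned rwN.
have eC : e \in completion F by rewrite in_setU eB orbT.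
have root_w := completion_connected F root w.
rewrite -(setD1K eC) {1}def_e in root_w.
case/connect_setU1: root_w => [rw | [_ zw] | [rz _]].
- by rewrite rw in rwN.
- by apply: connect_trans (connect_trans rw_pruned _);
    rewrite sym_connect_adj; apply: connect_adjS sDP _.
- by rewrite in_far_side rz in z_far.
Qed.

Lemma far_side_agree e F T : F \subset E -> T \subset E -> e \in bridges F ->
  agree_above e F T -> far_side F e = far_side T e.
Proof.
move=> sFE sTE eB agr; have eE := bridge_edge eB.
have eBT : e \in bridges T by rewrite -(bridges_agree eE agr).
rewrite (far_side_pruned sFE eB) (far_side_pruned sTE eBT).
by rewrite (pruned_agree eE (completion_agree eE agr)).
Qed.

Lemma far_end_agree e F T : F \subset E -> T \subset E -> e \in bridges F ->
  agree_above e F T -> far_end F e = far_end T e.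
Proof. by move=> sFE sTE eB agr; rewrite /far_end (far_side_agree sFE sTE). Qed.

Lemma far_side_closed F e : e \notin F -> closed (adj F) (far_side F e).
Proof.
move=> eF x y xy; have xyC : connect (adj (completion F :\ e)) x y.
  by apply: connect_adjS (connect_adj1 xy); rewrite subsetD1 subsetUl.
by rewrite !in_far_side (same_connect_r (@sym_connect_adj _ _) xyC).
Qed.

(* Following e from the root reaches the far end z of e without using f, whereas
   f cuts v off from the root. *)
Lemma far_ends_disconnected F e f z v : F \subset E ->
    e \in bridges F -> f \in bridges F -> e \notin F -> f \notin F -> e != f ->
  z \in far_end F e -> v \in far_end F f -> ~~ connect (adj F) z v.
Proof.
move=> sFE eB fB eF fF neq_ef z_end /setIP[vf v_far].
have [y [x [def_e y_near z_far def_end]]] := far_endP sFE eB.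
move: z_end; rewrite def_end => /set1P z_x; rewrite -z_x in def_e z_far.
have sFD g : g \notin F -> F \subset completion F :\ g.
  by move=> gF; rewrite subsetD1 subsetUl.
apply: contraL v_far => zv; rewrite in_far_side negbK.
have v_far_e : v \in far_side F e.
  by rewrite -(closed_connect (far_side_closed eF) zv).
have root_y : connect (adj (completion F :\ f)) root y.
  move: y_near; rewrite in_far_side negbK => /connect_inside.
  apply/connect_adjS/subsetP=> g /setIdP[/setD1P[_ gC] /subsetP g_near].
  rewrite in_setD1 gC andbT.
  by apply: contraTneq v_far_e => eq_gf; rewrite inE negbK g_near // eq_gf.
apply: connect_trans root_y (connect_trans _ (connect_adjS (sFD f fF) zv)).
by apply: connect_adj1; rewrite -def_e in_setD1 neq_ef in_setU eB orbT.
Qed.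

(* Walk in the spanning tree from the root to w, up to the first edge entering
   the component of w. *)
Lemma component_far_end F w : F \subset E -> ~~ connect (adj F) root w ->
  exists e z, [/\ e \in bridges F, z \in far_end F e & connect (adj F) z w].
Proof.
move=> sFE root_w; pose N := ~: component F w.
have rootN : root \in N by rewrite !inE sym_connect_adj.
have wN : w \notin N by rewrite in_setC negbK mem_component.
have [u [v [uvC root_u vN]]] :=
  connect_exit (completion_connected F root w) rootN wN.
have uN : u \in N.
  apply: contraT => uN.
  have [a [b [/setIdP[_ sabN] _]]] := connect_leave root_u rootN uN.
  by rewrite (subsetP sabN) ?set22.
have wv : connect (adj F) w v by move: vN; rewrite !inE negbK.
have uvF : [set u; v] \notin F.
  apply: contraL uN => uvF; rewrite !inE negbK (connect_trans wv) //.
  by rewrite sym_connect_adj connect_adj1.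
have uvB : [set u; v] \in bridges F by move: uvC; rewrite in_setU (negPf uvF).
exists [set u; v], v; split; rewrite 1?sym_connect_adj //.
have uv_cut := bridge_completion_spansN sFE uvB.
rewrite in_setI set22 in_far_side /=; apply: contra uv_cut => root_v.
rewrite spans2; apply: connect_trans root_v; rewrite sym_connect_adj.
apply: connect_adjS root_u; apply/subsetP=> e /setIdP[eC /subsetP sFN].
rewrite in_setD1 eC andbT.
by apply: contraNneq vN => eq_e; rewrite sFN // eq_e set22.
Qed.

(** * NBC states *)

Definition edges s : {set {set V}} := (val (val s)).1.
Definition xverts s : {set V} := xset (val (val s)).

Lemma edges_sub s : edges s \subset E.
Proof. by have /andP[] := valP (val s). Qed.

Lemma edges_nbc s : nbc E le (edges s).
Proof. exact: valP s. Qed.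

Lemma xverts_connect s u v :
  connect (adj (edges s)) u v -> (u \in xverts s) = (v \in xverts s).
Proof. exact: xset_connect. Qed.

Lemma nbc_state_ext s t : edges s = edges t -> xverts s = xverts t -> s = t.
Proof.
move=> eq_edges eq_xverts; do 2!apply: val_inj.
exact: state_ext (valP _) (valP _) eq_edges eq_xverts.
Qed.

Lemma nbc_state_exists F X : F \subset E -> nbc E le F -> closed (adj F) X ->
  exists s, edges s = F /\ xverts s = X.
Proof.
move=> sFE nbcF clX; pose s : state E := Sub _ (is_state_mk_state X sFE).
by exists (Sub s nbcF : nbc_state E le); split=> //; apply: xset_mk_state.
Qed.

Definition adds s e t : bool :=
  [&& e \in E, e \notin edges s
    & add_edge (val (val s)) e == Some (val (val t))].

Lemma adds_notin s e t : adds s e t -> e \notin edges s.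
Proof. by case/and3P. Qed.

Lemma adds_edge s e t : adds s e t -> e \in E.
Proof. by case/and3P. Qed.

Lemma adds_ends s e t : adds s e t -> exists u v, e = [set u; v].
Proof. by case/and3P=> /simpleE/eqP/cards2P[u [v [_ ->]]] _ _; exists u, v. Qed.

Lemma edges_adds s e t : adds s e t -> edges t = e |: edges s.
Proof.
move=> s_t; have [u [v def_e]] := adds_ends s_t.
by case/and3P: s_t; rewrite def_e => _ _ /eqP/add_edge_some[].
Qed.

Lemma adds_in s e t : adds s e t -> e \in edges t.
Proof. by move/edges_adds->; apply: setU11. Qed.

Lemma edges_adds_sub s e t : adds s e t -> edges s \subset edges t.
Proof. by move/edges_adds->; apply: subsetUr. Qed.

Lemma adds_functional s e t r : adds s e t -> adds s e r -> t = r.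
Proof.
case/and3P=> _ _ /eqP add_t /and3P[_ _ /eqP]; rewrite add_t => -[eq_t].
by do 2!apply: val_inj.
Qed.

Lemma xverts_adds s u v t w : adds s [set u; v] t ->
  (w \in xverts t) = (w \in xverts s) || ((u \in xverts s) || (v \in xverts s))
    && (w \in component (edges s) u :|: component (edges s) v).
Proof. by case/and3P=> _ _ /eqP/add_edge_some[_ _]. Qed.

Lemma xverts_adds_sub s e t : adds s e t -> xverts s \subset xverts t.
Proof.
move=> s_t; have [u [v def_e]] := adds_ends s_t; rewrite {e}def_e in s_t.
by apply/subsetP=> w ws; rewrite (xverts_adds _ s_t) ws.
Qed.

Lemma xverts_adds_source s e t w : adds s e t -> w \in xverts t ->
  exists2 x, x \in xverts s & connect (adj (edges t)) x w.
Proof.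
move=> s_t; have [u [v def_e]] := adds_ends s_t; rewrite {e}def_e in s_t.
have uv : connect (adj (edges t)) u v := connect_adj1 (adds_in s_t).
have conn_t x y : connect (adj (edges s)) x y -> connect (adj (edges t)) x y.
  exact/connect_adjS/edges_adds_sub/s_t.
rewrite (xverts_adds _ s_t) => /orP[ws | /andP[]]; first by exists w.
rewrite in_setU !in_component => /orP[uX | vX] /orP wU.
  by exists u => //; case: wU => /conn_t //; apply: connect_trans uv.
rewrite sym_connect_adj in uv.
by exists v => //; case: wU => /conn_t //; apply: connect_trans uv.
Qed.

(* Two components labelled x never merge, since x * x = 0. *)
Lemma xverts_adds_connect s e t x y : adds s e t ->
    x \in xverts s -> y \in xverts s ->
  connect (adj (edges t)) x y -> connect (adj (edges s)) x y.
Proof.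
move=> s_t; have [u [v def_e]] := adds_ends s_t; rewrite (edges_adds s_t).
case/and3P: s_t; rewrite {e}def_e => _ _ /eqP/add_edge_some[_ merge _] xX yX.
case/connect_setU1=> [// | [xu vy] | [xv uy]].
  have uv : connect (adj (edges s)) u v.
    apply: merge; rewrite -/(xverts s).
      by rewrite -(xverts_connect xu).
    by rewrite (xverts_connect vy).
  exact: connect_trans xu (connect_trans uv vy).
have vu : connect (adj (edges s)) v u.
  rewrite sym_connect_adj; apply: merge; rewrite -/(xverts s).
    by rewrite (xverts_connect uy).
  by rewrite -(xverts_connect xv).
exact: connect_trans xv (connect_trans vu uy).
Qed.

Lemma adds_defined s u v : [set u; v] \in E -> [set u; v] \notin edges s ->
    (u \in xverts s -> v \in xverts s -> connect (adj (edges s)) u v) ->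
    nbc E le ([set u; v] |: edges s) ->
  exists t, adds s [set u; v] t.
Proof.
move=> uvE uvN merge nbc_add; have [t s_t] := add_edge_defined merge.
have t_state := add_edge_state (valP (val s)) uvE (simpleE uvE) s_t.
have t_nbc : nbc E le (val (Sub t t_state : state E)).1.
  by case: (add_edge_some s_t) => /= ->.
by exists (Sub (Sub t t_state : state E) t_nbc); apply/and3P; rewrite s_t.
Qed.

Lemma adds_coef s e t :
  adds s e t -> coef d s t = edge_sign le (edges s) e.
Proof.
move=> s_t; rewrite coef_nbc_diff ffunE (big_pred1 e) // => f; rewrite in_setD.
apply/idP/eqP => [/andP[/andP[fN fE] add_f] | ->]; last first.
  by case/and3P: s_t => -> -> ->.
have s_f_t : adds s f t by apply/and3P.
have := adds_in s_f_t; rewrite (edges_adds s_t) in_setU1 => /predU1P[] //.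
by rewrite (negPf (adds_notin s_f_t)).
Qed.

Lemma adds_unit s e t :
  adds s e t -> coef d s t \is a GRing.unit.
Proof. by move/adds_coef->; rewrite /edge_sign GRing.unitrX ?GRing.unitrN1. Qed.

Lemma hasseP s t :
  reflect (exists e, adds s e t) (hasse d s t).
Proof.
apply: (iffP idP) => [|[e /adds_unit]]; last first.
  by apply: contraTneq => ->; rewrite GRing.unitr0.
rewrite /hasse coef_nbc_diff ffunE => coef_neq0.
case: (pickP (fun e => adds s e t)) => [e | no_e]; first by exists e.
case/eqP: coef_neq0; apply: big1 => e /andP[/setDP[eE eN] add_e].
by case/idP: (no_e e); apply/and3P.
Qed.

Definition xcomps N s : {set {set V}} :=
  (component (edges s) @: xverts s) ::&: N.

Lemma xcompsP N s D :
  reflect (exists w, [/\ D = component (edges s) w, w \in xverts s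
                       & component (edges s) w \subset N])
          (D \in xcomps N s).
Proof.
apply: (iffP setIdP) => [[/imsetP[w wX ->] sN] | [w [-> wX sN]]].
  by exists w.
by split=> //; apply: imset_f.
Qed.

Lemma xcomps_adds_sub N s e t : adds s e t ->
  xcomps N t \subset hull (edges t) @: xcomps N s.
Proof.
move=> s_t; have s_sub_t := edges_adds_sub s_t.
apply/subsetP=> _ /xcompsP[w [-> /(xverts_adds_source s_t)[x xX xw] sN]].
rewrite -eq_component in xw; rewrite -(eqP xw) in sN *.
rewrite -(hull_component _ s_sub_t); apply: imset_f.
apply/xcompsP; exists x; split=> //.
exact: subset_trans (componentS x s_sub_t) sN.
Qed.

Lemma leq_card_xcomps_adds N s e t :
  adds s e t -> #|xcomps N t| <= #|xcomps N s|.
Proof.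
move/(xcomps_adds_sub N)/subset_leq_card/leq_trans; apply.
exact: leq_imset_card.
Qed.

Lemma ltn_card_xcomps_adds N s y z t : adds s [set y; z] t ->
    z \in xverts s -> component (edges s) z \subset N -> y \notin N ->
  #|xcomps N t| < #|xcomps N s|.
Proof.
move=> s_t zX sN yN; set C := component (edges s) z in sN.
have C_in : C \in xcomps N s by apply/xcompsP; exists z.
rewrite [X in _ < X](cardsD1 C) C_in ltnS.
apply: leq_trans (leq_imset_card (hull (edges t)) _); apply: subset_leq_card.
apply/subsetP=> D D_in.
have /imsetP[K K_in def_D] := subsetP (xcomps_adds_sub N s_t) D D_in.
rewrite def_D; apply: imset_f; rewrite in_setD1 K_in andbT.
apply: contraNneq yN => eq_KC; have /xcompsP[w [eq_D _ sDN]] := D_in.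
rewrite -eq_D def_D eq_KC (hull_component _ (edges_adds_sub s_t)) in sDN.
apply: (subsetP sDN); rewrite inE sym_connect_adj connect_adj1 //.
exact: adds_in s_t.
Qed.

Lemma leq_card_xcomps_removes N s e t : adds s e t ->
    (forall w, w \in xverts s -> component (edges s) w \subset N ->
       component (edges t) w \subset N) ->
  #|xcomps N s| <= #|xcomps N t|.
Proof.
move=> s_t stay; have s_sub_t := edges_adds_sub s_t.
have hull_inj : {in xcomps N s &, injective (hull (edges t))}.
  move=> _ _ /xcompsP[x [-> xX _]] /xcompsP[y [-> yX _]].
  rewrite !hull_component // => /eqP; rewrite eq_component => xy.
  by apply/eqP; rewrite eq_component (xverts_adds_connect s_t).
rewrite -(card_in_imset hull_inj); apply: subset_leq_card.
apply/subsetP=> _ /imsetP[_ /xcompsP[w [-> wX sN]] ->].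
rewrite hull_component //; apply/xcompsP; exists w.
by split; [|exact: (subsetP (xverts_adds_sub s_t))|exact: stay].
Qed.

(** * The pivot matching *)

Definition far_unlabelled s e : bool :=
  [disjoint far_end (edges s) e & xverts s].

(* Adding or removing such an edge merges or splits off a component labelled 1
   at its far end. *)
Definition togglable s : {set {set V}} :=
  [set e in bridges (edges s) | (e \in edges s) || far_unlabelled s e].

Definition pivot s e : bool :=
  (e \in togglable s) && [forall f in togglable s, le f e].

Lemma togglable_bridge s e : e \in togglable s -> e \in bridges (edges s).
Proof. by case/setIdP. Qed.

Lemma togglable_edge s e : e \in togglable s -> e \in E.
Proof. by move/togglable_bridge/bridge_edge. Qed.

Lemma pivot_togglable s e : pivot s e -> e \in togglable s.
Proof. by case/andP. Qed.

Lemma pivot_max s e f : pivot s e -> f \in togglable s -> le f e.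
Proof. by case/andP=> _ /forall_inP; apply. Qed.

Lemma pivot_unique s e f : pivot s e -> pivot s f -> e = f.
Proof.
move=> pivot_e pivot_f.
have [te tf] := (pivot_togglable pivot_e, pivot_togglable pivot_f).
apply: (le_antisym_in (togglable_edge te) (togglable_edge tf)).
  exact: pivot_max te.
exact: pivot_max tf.
Qed.

Lemma pivot_exists s : togglable s != set0 -> exists e, pivot s e.
Proof.
have sTE : togglable s \subset E by apply/subsetP=> e; apply: togglable_edge.
case/(exists_maximum le_total le_trans sTE) => e te max_e.
by exists e; apply/andP; split=> //; apply/forall_inP.
Qed.

Lemma far_unlabelled1 s e z :
  far_end (edges s) e = [set z] -> far_unlabelled s e = (z \notin xverts s).
Proof. by rewrite /far_unlabelled => ->; apply: disjoints1. Qed.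

Lemma agree_above_setU1 e F : agree_above e F (e |: F).
Proof. by move=> f _ /negPf fe _; rewrite in_setU1 fe. Qed.

Lemma adds_agree s e t : adds s e t -> agree_above e (edges s) (edges t).
Proof. by move/edges_adds->; apply: agree_above_setU1. Qed.

Lemma xverts_adds_far_unlabelled s e t z : adds s e t ->
    e \in bridges (edges s) -> far_end (edges s) e = [set z] ->
    z \notin xverts s ->
  xverts s = xverts t :\: component (edges s) z.
Proof.
move=> s_t e_bridge def_end zN; apply/setP=> w; rewrite in_setD.
have [y [x [def_e _ _]]] := far_endP (edges_sub s) e_bridge.
rewrite def_end => /set1_inj eq_zx; rewrite -{x}eq_zx in def_e.
rewrite def_e in s_t; rewrite (xverts_adds _ s_t) (negPf zN) orbF in_setU.
have [wz|_] := boolP (w \in component _ z).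
  by rewrite in_component in wz; rewrite -(xverts_connect wz) (negPf zN).
rewrite orbF /=; case: (boolP (w \in component _ y)); rewrite ?andbF ?orbF //.
by rewrite in_component => /xverts_connect->; rewrite andbT orbb.
Qed.

Lemma far_unlabelled_adds s e t f :
    adds s e t -> e \in bridges (edges s) -> far_unlabelled s e ->
    f \in bridges (edges s) -> f \notin edges s -> e != f ->
  [disjoint far_end (edges s) f & xverts t] = far_unlabelled s f.
Proof.
move=> s_t e_bridge unlab f_bridge fN neq_ef.
have far_ends := far_endP (edges_sub s).
have [_ [z [_ _ _ end_e]]] := far_ends _ e_bridge.
have [_ [v [_ _ _ end_f]]] := far_ends _ f_bridge.
rewrite (far_unlabelled1 end_e) in unlab.
rewrite (far_unlabelled1 end_f) end_f disjoints1.
rewrite (xverts_adds_far_unlabelled s_t e_bridge end_e unlab).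
rewrite in_setD in_component.
have [z_end v_end] : z \in far_end (edges s) e /\ v \in far_end (edges s) f.
  by rewrite end_e end_f !set11.
have := far_ends_disconnected (edges_sub s) e_bridge f_bridge.
by move/(_ _ _ (adds_notin s_t) fN neq_ef z_end v_end)/negPf->.
Qed.

Lemma togglable_adds s e t f : adds s e t -> e \in bridges (edges s) ->
    far_unlabelled s e -> f \in E -> le e f ->
  (f \in togglable s) = (f \in togglable t).
Proof.
move=> s_t e_bridge unlab fE ef; have eE := adds_edge s_t.
have agr := adds_agree s_t.
have agr_f := agree_above_le eE fE ef agr.
rewrite [in LHS]in_set [in RHS]in_set -(bridges_agree fE agr_f).
have [f_bridge /= | //] := boolP (f \in _).
have [-> | neq_fe] := eqVneq f e; first by rewrite unlab orbT (adds_in s_t).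
rewrite -(agr f fE neq_fe ef); have [// | fN /=] := boolP (f \in edges s).
have eq_end := far_end_agree (edges_sub s) (edges_sub t) f_bridge agr_f.
rewrite eq_sym in neq_fe; rewrite [in RHS]/far_unlabelled -eq_end.
exact/esym/(far_unlabelled_adds s_t e_bridge unlab f_bridge fN neq_fe).
Qed.

Lemma pivot_adds s e t :
  adds s e t -> far_unlabelled s e -> pivot s e = pivot t e.
Proof.
move=> s_t unlab; have eE := adds_edge s_t.
have [e_bridge | eN] := boolP (e \in bridges (edges s)); last first.
  have eNt : e \notin bridges (edges t).
    by rewrite -(bridges_agree eE (adds_agree s_t)).
  by rewrite /pivot [in LHS]in_set [in RHS]in_set (negPf eN) (negPf eNt).
have tog f := togglable_adds s_t e_bridge unlab (f := f).
rewrite /pivot (tog e eE (le_refl_in eE)); congr andb; apply: eq_forallb => f.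
have [// | nfe] := boolP (le f e); first by rewrite !implybT.
have [fE | fNE] := boolP (f \in E).
  by rewrite tog //; have := le_total eE fE; rewrite (negPf nfe) orbF.
have fN r : (f \in togglable r) = false.
  by apply: contraNF fNE; apply: togglable_edge.
by rewrite !fN.
Qed.

Lemma merge_far_unlabelled s e : e \in bridges (edges s) -> e \notin edges s ->
  far_unlabelled s e -> exists t, adds s e t.
Proof.
move=> e_bridge eN unlab; have eE := bridge_edge e_bridge.
have [y [z [def_e _ _ def_end]]] := far_endP (edges_sub s) e_bridge.
rewrite (far_unlabelled1 def_end) in unlab.
have nbc_e := setU1_bridge_nbc (edges_nbc s) e_bridge.
rewrite def_e in eE eN nbc_e *; apply: adds_defined => // _.
by rewrite (negPf unlab).
Qed.

Lemma split_far_unlabelled t e : e \in bridges (edges t) -> e \in edges t ->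
  exists2 s, adds s e t & far_unlabelled s e.
Proof.
move=> e_bridge e_in; have eE := bridge_edge e_bridge; set F := edges t :\ e.
have sFt : F \subset edges t := subsetDl _ _.
have sFE := subset_trans sFt (edges_sub t).
have def_t : e |: F = edges t by rewrite setD1K.
have agr : agree_above e F (edges t).
  by rewrite -def_t; apply: agree_above_setU1.
have e_bridgeF : e \in bridges F by rewrite (bridges_agree eE agr).
have [y [z [def_e y_near z_far def_end]]] := far_endP sFE e_bridgeF.
have clX : closed (adj F) (xverts t :\: component F z).
  move=> u v uv; rewrite !in_setD !in_component.
  rewrite (same_connect_r (@sym_connect_adj _ F) (connect1 uv)).
  by rewrite (xverts_connect (connect_adjS sFt (connect1 uv))).
have [s [edges_s xverts_s]] :=
  nbc_state_exists sFE (nbcS sFt (edges_nbc t)) clX.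
rewrite -edges_s in def_end def_t e_bridgeF.
have z_unlab : z \notin xverts s by rewrite xverts_s in_setD mem_component.
have unlab : far_unlabelled s e by rewrite (far_unlabelled1 def_end).
have eN : e \notin edges s by rewrite edges_s setD11.
exists s => //; have [r s_r] := merge_far_unlabelled e_bridgeF eN unlab.
suff <- : r = t by [].
have edges_r : edges r = edges t by rewrite (edges_adds s_r).
apply: nbc_state_ext => //.
have yz : connect (adj (edges t)) y z by apply: connect_adj1; rewrite -def_e.
have y_apart : ~~ connect (adj F) z y.
  apply: contra y_near => zy; have eNF : e \notin F by rewrite setD11.
  by rewrite -(closed_connect (far_side_closed eNF) zy).
apply/setP=> w; rewrite def_e in s_r;
  rewrite (xverts_adds _ s_r) (negPf z_unlab) orbF.
rewrite xverts_s edges_s !in_setD in_setU !in_component y_apart /=.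
have [zw | zwN] /= := boolP (connect (adj F) z w).
  by rewrite orbT andbT
    (xverts_connect (connect_trans yz (connect_adjS sFt zw))).
rewrite orbF; have [yw | ywN] := boolP (connect (adj F) y w);
  last by rewrite andbF orbF.
by rewrite andbT (xverts_connect (connect_adjS sFt yw)) orbb.
Qed.

Lemma far_unlabelled_adds_inj r s e t : adds r e t -> adds s e t ->
    e \in bridges (edges s) -> far_unlabelled r e -> far_unlabelled s e ->
  r = s.
Proof.
move=> r_t s_t e_bridge r_unlab s_unlab.
have eq_edges : edges r = edges s.
  rewrite -(setU1K (adds_notin r_t)) -(setU1K (adds_notin s_t)).
  by rewrite -(edges_adds r_t) -(edges_adds s_t).
have [_ [z [_ _ _ def_end]]] := far_endP (edges_sub s) e_bridge.
have e_bridge_r : e \in bridges (edges r) by rewrite eq_edges.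
have def_end_r : far_end (edges r) e = [set z] by rewrite eq_edges.
rewrite (far_unlabelled1 def_end_r) in r_unlab.
rewrite (far_unlabelled1 def_end) in s_unlab.
apply: nbc_state_ext => //.
rewrite (xverts_adds_far_unlabelled r_t e_bridge_r def_end_r r_unlab) eq_edges.
by rewrite -(xverts_adds_far_unlabelled s_t e_bridge def_end s_unlab).
Qed.

Definition pivot_matching : {set nbc_state E le * nbc_state E le} :=
  [set p | [exists e, adds p.1 e p.2 && pivot p.1 e]].

Lemma pivot_matchingP s t :
  reflect (exists e, [/\ adds s e t, far_unlabelled s e, pivot s e & pivot t e])
          ((s, t) \in pivot_matching).
Proof.
rewrite inE; apply: (iffP existsP) => -[e].
  case/andP=> /= s_t pivot_s; exists e.
  have unlab : far_unlabelled s e.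
    have := pivot_togglable pivot_s.
    by rewrite inE (negPf (adds_notin s_t)) => /andP[].
  by split; rewrite // -(pivot_adds s_t unlab).
by case=> s_t _ pivot_s _; exists e; rewrite s_t.
Qed.

Lemma pivot_matching_is_matching : matching d pivot_matching.
Proof.
apply: matching_intro => [s t | s t u | s t u | s t u] /pivot_matchingP[e].
- by case=> s_t _ _ _; apply/hasseP; exists e.
- move=> [s_t _ pivot_e _] /pivot_matchingP[f [s_u _ pivot_f _]].
  rewrite -(pivot_unique pivot_e pivot_f) in s_u.
  exact: adds_functional s_t s_u.
- move=> [s_u s_unlab pivot_s pivot_e]
    /pivot_matchingP[f [t_u t_unlab pivot_t pivot_f]].
  rewrite -(pivot_unique pivot_e pivot_f) in t_u t_unlab pivot_t.
  by apply: far_unlabelled_adds_inj s_u t_u _ s_unlab t_unlab;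
     apply/togglable_bridge/pivot_togglable.
- move=> [s_t _ _ pivot_e]; apply/pivot_matchingP=> -[f [t_u _ pivot_f _]].
  have := adds_notin t_u.
  by rewrite -(pivot_unique pivot_e pivot_f) (adds_in s_t).
Qed.

Lemma hasse_card_edges s t : hasse d s t -> #|edges t| = #|edges s|.+1.
Proof.
by case/hasseP=> e s_t; rewrite (edges_adds s_t) cardsU1 (adds_notin s_t).
Qed.

(** * Acyclicity *)

Section ReversedCycle.

Variable c : seq (nbc_state E le).
Hypothesis cycle_c : cycle (reversed d pivot_matching) c.

Definition varying : {set {set V}} :=
  [set g in E | has (fun s => g \in edges s) c
                & has (fun s => g \notin edges s) c].

Lemma varyingP g :
  reflect (exists s t, [/\ s \in c, t \in c, g \in E, g \in edges s
                         & g \notin edges t])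
          (g \in varying).
Proof.
apply: (iffP setIdP) => [[gE /andP[/hasP[s sc gs] /hasP[t tc gt]]] | ].
  by exists s, t.
case=> s [t [sc tc gE gs gt]]; split=> //.
by apply/andP; split; apply/hasP; [exists s | exists t].
Qed.

Lemma adds_varying s g t : s \in c -> t \in c -> adds s g t -> g \in varying.
Proof.
move=> sc tc s_t; apply/varyingP; exists t, s.
by rewrite (adds_edge s_t) (adds_in s_t) (adds_notin s_t).
Qed.

Lemma reversed_cases s t : reversed d pivot_matching s t ->
  (exists g, adds s g t) \/ (t, s) \in pivot_matching.
Proof. by case/orP=> [/andP[/hasseP]|]; [left | right]. Qed.

Lemma varying_neq0 : c != [::] -> varying != set0.
Proof.
case def_c: c => [//|s p] _; have sc : s \in c by rewrite def_c mem_head.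
have tc : next c s \in c by rewrite mem_next.
apply/set0Pn; case: (reversed_cases (next_cycle cycle_c sc)) => [[g s_t]|].
  by exists g; apply: adds_varying s_t.
by case/pivot_matchingP=> g [t_s _ _ _]; exists g; apply: adds_varying t_s.
Qed.

Variable e : {set V}.
Hypothesis e_varying : e \in varying.
Hypothesis max_e : forall g, g \in varying -> le g e.

Lemma varying_edge : e \in E.
Proof. by case/setIdP: e_varying. Qed.

Lemma cycle_agree s t : s \in c -> t \in c -> agree_above e (edges s) (edges t).
Proof.
have edges_sub_above r q g : r \in c -> q \in c -> g \in E -> g != e ->
    le e g -> g \in edges r -> g \in edges q.
  move=> rc qc gE neq_ge eg gr; apply: contraNT neq_ge => gq.
  apply/eqP/le_antisym_in => //; first exact: varying_edge.
  by apply/max_e/varyingP; exists r, q.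
by move=> sc tc g gE neq_ge eg; apply/idP/idP; apply: edges_sub_above.
Qed.

Lemma cycle_pivot : exists2 t, t \in c & pivot t e.
Proof.
have [s [t [sc tc _ es /negPf et]]] := varyingP _ e_varying.
pose keeps a b := (e \in edges a) ==> (e \in edges b).
have keeps_trans : transitive keeps.
  by move=> b a u /implyP ab /implyP bu; apply/implyP=> /ab/bu.
have keepsN : ~~ keeps s t by rewrite /keeps es et.
have [a [b [_ bc]]] := cycle_not_rel keeps_trans cycle_c sc tc keepsN.
case/reversed_cases=> [[g a_b]|/pivot_matchingP[g [b_a _ pivot_g _]]];
  rewrite negb_imply => /andP[ea eb].
  by rewrite (subsetP (edges_adds_sub a_b)) in eb.
exists b => //; suff <- : g = e by [].
by move: ea; rewrite (edges_adds b_a) in_setU1 (negPf eb) orbF => /eqP.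
Qed.

Lemma cycle_bridge s : s \in c -> e \in bridges (edges s).
Proof.
have [t tc pivot_e] := cycle_pivot.
move=> sc; rewrite (bridges_agree varying_edge (cycle_agree sc tc)).
exact/togglable_bridge/pivot_togglable.
Qed.

Lemma cycle_far_side s t :
  s \in c -> t \in c -> far_side (edges s) e = far_side (edges t) e.
Proof.
move=> sc tc; have agr := cycle_agree sc tc.
exact: far_side_agree (edges_sub s) (edges_sub t) (cycle_bridge sc) agr.
Qed.

Lemma varying_pivot_eq s m : s \in c -> m \in varying -> pivot s m ->
  e \in edges s -> m = e.
Proof.
move=> sc m_varying pivot_m es; have /setIdP[mE _] := m_varying.
apply: (le_antisym_in mE varying_edge (max_e m_varying)).
by apply: (pivot_max pivot_m); rewrite inE cycle_bridge ?es.
Qed.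

(* Since steps alternate, the step adding e is followed by one removing the
   pivot, which is e; had the far component been labelled 1, the latter would
   undo the former. *)
Lemma cycle_adds_labelled :
  exists s t, [/\ s \in c, t \in c, adds s e t & ~~ far_unlabelled s e].
Proof.
have [u [v [uc vc _ eu /negPf ev]]] := varyingP _ e_varying.
pose keeps_out a b := (e \in edges b) ==> (e \in edges a).
have keeps_out_trans : transitive keeps_out.
  by move=> b a x /implyP ba /implyP xb; apply/implyP=> /xb/ba.
have keeps_outN : ~~ keeps_out v u by rewrite /keeps_out eu ev.
have [s [t [sc tc step_st]]] :=
  cycle_not_rel keeps_out_trans cycle_c vc uc keeps_outN.
rewrite negb_imply => /andP[et es].
have [s_t stM] : adds s e t /\ (s, t) \notin pivot_matching.
  case/orP: step_st =>
    [/andP[/hasseP[g s_t] stM] | /pivot_matchingP[g [t_s _ _ _]]].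
    split=> //; suff <- : g = e by [].
    by move: et; rewrite (edges_adds s_t) in_setU1 (negPf es) orbF => /eqP.
  by rewrite (subsetP (edges_adds_sub t_s)) in es.
exists s, t; split=> //; apply: contra stM => unlab.
set r := next c t; have rc : r \in c by rewrite mem_next.
have rtM : (r, t) \in pivot_matching.
  have hasse_st : hasse d s t by apply/hasseP; exists e.
  exact: (reversed_cycle_alternates pivot_matching_is_matching
    hasse_card_edges cycle_c sc tc rc hasse_st (next_cycle cycle_c tc)).
have /pivot_matchingP[m [r_t unlab_r _ pivot_m]] := rtM.
have eq_me := varying_pivot_eq tc (adds_varying rc tc r_t) pivot_m et.
rewrite {m pivot_m}eq_me in r_t unlab_r.
by rewrite (far_unlabelled_adds_inj s_t r_t (cycle_bridge rc) unlab unlab_r).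
Qed.

Lemma cycle_xcomps_noninc s t : s \in c -> t \in c ->
    reversed d pivot_matching s t ->
  #|xcomps (far_side (edges s) e) t| <= #|xcomps (far_side (edges s) e) s|.
Proof.
move=> sc tc; set N := far_side _ e.
case/reversed_cases=> [[g s_t]|]; first exact: leq_card_xcomps_adds s_t.
case/pivot_matchingP=> m [t_s unlab _ pivot_m].
apply: (leq_card_xcomps_removes t_s) => w wX sN.
have wN : w \in N by apply: (subsetP sN); apply: mem_component.
have [es | esN] := boolP (e \in edges s); last first.
  by rewrite (closed_component_sub _ (far_side_closed esN)).
have eq_me := varying_pivot_eq sc (adds_varying tc sc t_s) pivot_m es.
rewrite {m pivot_m}eq_me in t_s unlab.
have [y [z [def_e y_near _ def_end]]] :=
  far_endP (edges_sub t) (cycle_bridge tc).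
rewrite (far_unlabelled1 def_end) in unlab.
rewrite (cycle_far_side tc sc) -/N in y_near.
rewrite (edges_adds t_s) def_e component_setU1 ifF // in_setU !in_component.
apply/norP; split.
  apply: contra y_near => yw; apply: (subsetP sN).
  by rewrite in_component sym_connect_adj.
by apply: contra unlab => zw; rewrite (xverts_connect zw).
Qed.

Lemma no_max_varying : False.
Proof.
have [s [t [sc tc s_t labelled]]] := cycle_adds_labelled.
have [y [z [def_e y_near z_far def_end]]] :=
  far_endP (edges_sub s) (cycle_bridge sc).
rewrite (far_unlabelled1 def_end) negbK in labelled.
set N := far_side (edges s) e in y_near z_far.
have sCN : component (edges s) z \subset N.
  by rewrite (closed_component_sub _ (far_side_closed (adds_notin s_t))).
rewrite def_e in s_t; have := ltn_card_xcomps_adds s_t labelled sCN y_near.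
rewrite ltnNge => /negP[]; pose noninc a b := #|xcomps N b| <= #|xcomps N a|.
have noninc_trans : transitive noninc.
  by move=> b a u ba ub; apply: leq_trans ub ba.
apply: contraT => incr.
have [a [b [ac bc step_ab]]] := cycle_not_rel noninc_trans cycle_c tc sc incr.
by rewrite /noninc /N (cycle_far_side sc ac) cycle_xcomps_noninc.
Qed.

End ReversedCycle.

Lemma pivot_matching_acyclic c :
  cycle (reversed d pivot_matching) c -> c = [::].
Proof.
move=> cycle_c; apply/eqP; apply: contraT => c_neq0.
have varyingE : varying c \subset E by apply/subsetP=> g /setIdP[].
have [e e_varying max_e] :=
  exists_maximum le_total le_trans varyingE (varying_neq0 cycle_c c_neq0).
by case: (no_max_varying cycle_c e_varying max_e).
Qed.

Lemma pivot_matching_is_acyclic : acyclic_matching d pivot_matching.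
Proof.
split; [exact: pivot_matching_is_matching | | exact: pivot_matching_acyclic].
by move=> [s t] /pivot_matchingP[e [s_t _ _ _]]; apply: adds_unit s_t.
Qed.

(** * Critical states *)

Lemma critical_togglable s : critical pivot_matching s = (togglable s == set0).
Proof.
apply/forall_inP/eqP => [crit | tog0 [r t]].
  apply/eqP; apply: contraT => /pivot_exists[e pivot_e].
  have := pivot_togglable pivot_e; rewrite inE => /andP[e_bridge].
  have [es _ | es /= unlab] := boolP (e \in edges s).
    have [r r_s unlab] := split_far_unlabelled e_bridge es.
    have /crit : (r, s) \in pivot_matching.
      by apply/pivot_matchingP; exists e; rewrite (pivot_adds r_s unlab).
    by rewrite eqxx andbF.
  have [t s_t] := merge_far_unlabelled e_bridge es unlab.
  have /crit : (s, t) \in pivot_matching.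
    by apply/pivot_matchingP; exists e; rewrite -(pivot_adds s_t unlab).
  by rewrite eqxx.
case/pivot_matchingP=> e [_ _ /pivot_togglable e_r /pivot_togglable e_t] /=.
apply/andP; split; apply: contraTneq isT => eq_s.
  by rewrite -eq_s tog0 inE in e_r.
by rewrite -eq_s tog0 inE in e_t.
Qed.

Lemma critical_disjoint_bridges s :
  critical pivot_matching s -> [disjoint edges s & bridges (edges s)].
Proof.
rewrite critical_togglable => /eqP tog0.
rewrite -setI_eq0; apply/eqP/setP=> e; rewrite in_setI in_set0.
apply/negP=> /andP[es eB].
by have := in_set0 e; rewrite -tog0 in_set eB es.
Qed.

Lemma critical_far_end s e : critical pivot_matching s ->
  e \in bridges (edges s) -> far_end (edges s) e \subset xverts s.
Proof.
rewrite critical_togglable => /eqP tog0 eB.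
have [_ [z [_ _ _ def_end]]] := far_endP (edges_sub s) eB.
have /negbT := in_set0 e.
rewrite -tog0 in_set eB (far_unlabelled1 def_end) negb_or negbK => /andP[_].
by rewrite def_end sub1set.
Qed.

Lemma critical_xverts s w : critical pivot_matching s ->
  (w \in xverts s) = (connect (adj (edges s)) root w ==> (root \in xverts s)).
Proof.
move=> crit; have [root_w | rootN] /= := boolP (connect _ root w).
  by rewrite (xverts_connect root_w).
have [e [z [eB z_end zw]]] := component_far_end (edges_sub s) rootN.
by rewrite -(xverts_connect zw) (subsetP (critical_far_end crit eB)).
Qed.

Lemma critical_state_inj s t :
    critical pivot_matching s -> critical pivot_matching t ->
    completion (edges s) = completion (edges t) ->
    (root \in xverts s) = (root \in xverts t) ->
  s = t.
Proof.
move=> crit_s crit_t eq_tree eq_root.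
have edgesE r : critical pivot_matching r ->
    edges r = completion (edges r) :\: bridges (completion (edges r)).
  move/critical_disjoint_bridges=> disj.
  by rewrite bridges_of_completion setD_completion_bridges.
have eq_edges : edges s = edges t.
  by rewrite (edgesE s crit_s) (edgesE t crit_t) eq_tree.
apply: (nbc_state_ext eq_edges); apply/setP=> w.
by rewrite (critical_xverts w crit_s) eq_edges eq_root -critical_xverts.
Qed.

Lemma critical_state_exists T (b : bool) : nbc_tree E le T ->
  exists s, [/\ critical pivot_matching s, completion (edges s) = T
              & (root \in xverts s) = b].
Proof.
case/andP=> treeT nbcT; pose F := T :\: bridges T.
have def_T : completion F = T := completion_setD_bridges treeT.
have sTE : T \subset E by case/and3P: treeT.
have sFE : F \subset E := subset_trans (subsetDl _ _) sTE.
pose X := [set w | connect (adj F) root w ==> b].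
have clX : closed (adj F) X.
  move=> u v uv; rewrite !inE; congr (_ ==> _).
  exact: (same_connect_r (@sym_connect_adj _ F) (connect1 uv)).
have [s [edges_s xverts_s]] :=
  nbc_state_exists sFE (nbcS (subsetDl _ _) nbcT) clX.
exists s; split; [ | by rewrite edges_s | by rewrite xverts_s inE connect0].
rewrite critical_togglable; apply/eqP/setP=> e; rewrite in_set0.
apply/negbTE/negP=> e_tog; have e_bridge := togglable_bridge e_tog.
have [_ [z [_ _ z_far def_end]]] := far_endP (edges_sub s) e_bridge.
have eN : e \notin F.
  by move: e_bridge; rewrite edges_s -bridges_of_completion def_T in_setD => ->.
move: e_tog; rewrite in_set e_bridge (far_unlabelled1 def_end).
rewrite edges_s (negPf eN) /=.
rewrite xverts_s inE => /negP[]; apply/implyP=> root_z.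
move: z_far; rewrite in_far_side edges_s => /negP[]; apply: connect_adjS root_z.
by rewrite subsetD1 subsetUl.
Qed.

Definition signed_tree (c : {s : nbc_state E le | critical pivot_matching s}) :
    {T : {set {set V}} | nbc_tree E le T} * bool :=
  (Sub (completion (edges (val c)))
     (completion_nbc_tree (edges_sub (val c)) (edges_nbc (val c))),
   root \in xverts (val c)).

Lemma signed_tree_bij : bijective signed_tree.
Proof.
have inj : injective signed_tree.
  move=> b c eq_bc; apply: val_inj.
  apply: critical_state_inj (valP b) (valP c) _ _.
    exact: (congr1 (fun p => val p.1) eq_bc).
  exact: (congr1 snd eq_bc).
have surj p : exists c, signed_tree c == p.
  case: p => -[T nbcT] b.
  have [s [crit_s tree_s root_s]] := critical_state_exists b nbcT.
  by exists (Sub s crit_s); apply/eqP; congr pair; [apply: val_inj | ].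
exists (fun p => xchoose (surj p)) => [c | p].
  exact/inj/eqP/(xchooseP (surj _)).
exact/eqP/(xchooseP (surj p)).
Qed.

End NbcComplex.

Theorem theorem3p6 (V : finType) (E : {set {set V}}) (le : rel {set V}) (vd : V)
    (simpleE : forall e : {set V}, e \in E -> #|e| = 2)
    (connE : connected_graph E)
    (le_total : {in E &, total le})
    (le_anti : {in E &, antisymmetric le})
    (le_trans : {in E & &, transitive le}) :
  exists M : {set nbc_state E le * nbc_state E le},
    acyclic_matching (@nbc_diff V E le) M /\
    exists f : {c : nbc_state E le | critical M c} ->
               {T : {set {set V}} | nbc_tree E le T} * bool,
      bijective f.
Proof.
exists (pivot_matching E le vd); split; first exact: pivot_matching_is_acyclic.
exists (signed_tree simpleE le_total le_anti le_trans connE).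
exact: signed_tree_bij.
Qed.
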